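(* Let $R$ be a commutative ring with $1\neq 0$ and let $Q$ be an irreducible ideal of $R$. Then $Q$ is special 2-absorbing primary if and only if $(Q:_R x)=(Q:_R x^2)$ for every $x\in R\setminus\sqrt{Q}$.
   Context: All rings are commutative with $1\neq 0$. An ideal $Q$ is irreducible if it is proper and $Q=I\cap J$ for ideals $I,J$ of $R$ implies $Q=I$ or $Q=J$. A proper ideal $Q$ of $R$ is special 2-absorbing primary if whenever $a,b,c\in R$ satisfy $abc\in Q$, $ab\notin Q$ and $ac\notin\sqrt{Q}$, then $bc\in Q$. Here $\sqrt{Q}$ is the radical of $Q$, and $(Q:_R x)=\{r\in R : rx\in Q\}$. *)

(* Defs.v *)
From mathcomp Require Import all_boot all_algebra.
From mathcomp Require Import boolp classical_sets.

Set Implicit Arguments.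
Unset Strict Implicit.
Unset Printing Implicit Defensive.

Import GRing.Theory.
Local Open Scope classical_set_scope.
Local Open Scope ring_scope.

(* Ideals are arbitrary subsets [set R] rather than instances of MathComp's
   [idealr], which only covers decidable ideals that do not contain 1.
   Closure under opposite is the case a = -1 of the last clause. *)
Definition is_ideal (R : comNzRingType) (I : set R) : Prop :=
  [/\ I 0,
      forall x y : R, I x -> I y -> I (x + y)
    & forall a x : R, I x -> I (a * x)].

Definition is_proper_ideal (R : comNzRingType) (I : set R) : Prop :=
  is_ideal I /\ I <> setT.

Definition radical (R : comNzRingType) (I : set R) : set R :=
  [set x | exists2 n : nat, (0 < n)%N & I (x ^+ n)].

Definition colon (R : comNzRingType) (I : set R) (x : R) : set R :=
  [set r | I (r * x)].

Definition irreducible_ideal (R : comNzRingType) (Q : set R) : Prop :=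
  is_proper_ideal Q /\
  forall I J : set R, is_ideal I -> is_ideal J ->
    Q = I `&` J -> Q = I \/ Q = J.

Definition special_2_absorbing_primary (R : comNzRingType) (Q : set R) : Prop :=
  is_proper_ideal Q /\
  forall a b c : R,
    Q (a * b * c) -> ~ Q (a * b) -> ~ radical Q (a * c) -> Q (b * c).

(* Main.v *)
Require Import Defs.
From mathcomp Require Import all_boot all_algebra.
From mathcomp Require Import boolp classical_sets.
From mathcomp Require Import ring.

Set Implicit Arguments.
Unset Strict Implicit.
Unset Printing Implicit Defensive.

Import GRing.Theory.
Local Open Scope classical_set_scope.
Local Open Scope ring_scope.

(** If [Q] is special 2-absorbing primary, [x] is outside its radical and
    [r * x ^+ 2] lies in [Q], then the defining property applied to the triple
    [x, r, x] leaves no way for [r * x] to miss [Q], because [x ^+ 2] is outside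
    the radical as well ([special_colon_sq]).

    Conversely, let [a * b * c] be in [Q] with [a * c] outside the radical, so
    that [c] is outside it too. The ideals Q + (ab) and Q + (bc) meet exactly
    in [Q]: multiplying a common element by [c] sends it into [Q], because
    [a * b * c] is in [Q]; hence its (bc)-component is killed modulo [Q] by a
    further [c], and the colon condition at [c] says that this component was in
    [Q] already ([adjoin_meet]). Irreducibility then forces one of [a * b],
    [b * c] into [Q]. *)

Definition adjoin (R : comNzRingType) (Q : set R) (x : R) : set R :=
  [set z | exists r : R, exists2 q : R, Q q & z = q + r * x].

Lemma ideal_subr (R : comNzRingType) (I : set R) (x y : R) :
  is_ideal I -> I x -> I y -> I (x - y).
Proof. by move=> [_ ID IM] Ix Iy; rewrite -mulN1r; apply/ID/IM. Qed.

Lemma adjoin_ideal (R : comNzRingType) (Q : set R) (x : R) :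
  is_ideal Q -> is_ideal (adjoin Q x).
Proof.
move=> [Q0 QD QM]; split.
- by exists 0, 0 => //; ring.
- move=> _ _ [r [p Qp ->]] [s [q Qq ->]].
  by exists (r + s), (p + q); [exact: QD | ring].
- move=> a _ [r [q Qq ->]].
  by exists (a * r), (a * q); [exact: QM | ring].
Qed.

Lemma adjoin_self (R : comNzRingType) (Q : set R) (x : R) :
  is_ideal Q -> adjoin Q x x.
Proof. by move=> [Q0 _ _]; exists 1, 0 => //; ring. Qed.

Lemma sub_adjoin (R : comNzRingType) (Q : set R) (x : R) : Q `<=` adjoin Q x.
Proof. by move=> q Qq; exists 0, q => //; ring. Qed.

Lemma radicalMl (R : comNzRingType) (Q : set R) (a x : R) :
  is_ideal Q -> radical Q x -> radical Q (a * x).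
Proof.
by move=> [_ _ QM] [n n0 Qxn]; exists n => //; rewrite exprMn; apply: QM.
Qed.

Lemma radical_expr (R : comNzRingType) (Q : set R) (x : R) (k : nat) :
  (0 < k)%N -> radical Q (x ^+ k) -> radical Q x.
Proof.
move=> k0 [n n0]; rewrite -exprM => Qxkn.
by exists (k * n)%N => //; rewrite muln_gt0 k0.
Qed.

(** Modulo [Q], the element [c] annihilates [x], while the colon condition
    makes [c] act injectively on the multiples of [c]; so the images of (x) and
    (yc) in the quotient meet only in zero. *)
Lemma adjoin_meet (R : comNzRingType) (Q : set R) (x y c : R) :
  is_ideal Q -> colon Q c = colon Q (c ^+ 2) -> Q (x * c) ->
  Q = adjoin Q x `&` adjoin Q (y * c).
Proof.
move=> Qid Qc Qxc; have [_ QD QM] := Qid.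
apply/seteqP; split=> [q Qq|z [[r [p Qp zE]] [s [q Qq zE']]]].
  by split; apply: sub_adjoin.
have Qcz : Q (c * z).
  have -> : c * z = c * p + r * (x * c) by rewrite zE; ring.
  by apply: QD; apply: QM.
suff Qsyc : colon Q c (s * y).
  by rewrite zE' mulrA; apply: QD.
rewrite Qc /colon /=.
have -> : s * y * c ^+ 2 = c * z - c * q by rewrite zE'; ring.
exact: ideal_subr (QM _ _ Qq).
Qed.

Lemma special_colon_sq (R : comNzRingType) (Q : set R) (x : R) :
  special_2_absorbing_primary Q -> ~ radical Q x ->
  colon Q x = colon Q (x ^+ 2).
Proof.
move=> [[[_ _ QM] _] Qsp] radNx.
apply/seteqP; split=> r; rewrite /colon /= => Qr.
  by have -> : r * x ^+ 2 = x * (r * x) by [ring]; apply: QM.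
apply: contrapT => QNrx; apply/QNrx/(Qsp x r x).
- by have -> : x * r * x = r * x ^+ 2 by ring.
- by rewrite mulrC.
- by rewrite -expr2 => /radical_expr; apply: contra_not radNx; apply.
Qed.

Theorem theorem3p7 (R : comNzRingType) (Q : set R)
    (Qirr : irreducible_ideal Q) :
  special_2_absorbing_primary Q <->
  (forall x : R, ~ radical Q x -> colon Q x = colon Q (x ^+ 2)).
Proof.
split=> [Qsp x|Qcolon]; first exact: special_colon_sq.
have [[Qid Qproper] Qmeet] := Qirr.
split=> // a b c Qabc QNab radNac.
have radNc : ~ radical Q c by move=> /(radicalMl a Qid).
case: (Qmeet _ _ (adjoin_ideal (a * b) Qid) (adjoin_ideal (b * c) Qid)
         (adjoin_meet b Qid (Qcolon c radNc) Qabc)) => QE.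
- by case: QNab; rewrite QE; apply: adjoin_self.
- by rewrite QE; apply: adjoin_self.
Qed.
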